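(* Let $\varphi=\frac{1+\sqrt5}{2}$ and $\varkappa_1=4$. (i) Let $x=[a_1,a_2,\ldots,a_t,\ldots]\in(0,1)$ be irrational and suppose $$\limsup_{t\to\infty}\frac{S^{\varphi}_{2t}(x)}{t}<\varkappa_1 .$$ Then the derivative $g'_{\varphi^{-1}}(x)$ exists and equals $+\infty$. (ii) For every $\delta>0$ there exists an irrational $y=[b_1,\ldots,b_t,\ldots]\in(0,1)$ such that the limit $\lim_{t\to\infty}\frac{S^{\varphi}_{2t}(y)}{t}$ exists, satisfies $$\lim_{t\to\infty}\frac{S^{\varphi}_{2t}(y)}{t}<\varkappa_1+\delta,$$ and $g'_{\varphi^{-1}}(y)=0$.
   Context: For irrational $x\in(0,1)$ write $x=[a_1,a_2,\ldots]=[0;a_1,a_2,\ldots]$ for its regular continued fraction expansion with partial quotients $a_i\ge 1$. Define $S^{\varphi}_t(x)=\sum_{i=1}^t a_i\left(\frac32+\frac12(-1)^i\right)=a_1+2a_2+a_3+2a_4+\cdots$ (the first $t$ terms). For $\lambda\in(0,1)$ the Denjoy–Tichy–Uitz function $g_\lambda:[0,1]\to[0,1]$ is defined by $g_\lambda(0/1)=0$, $g_\lambda(1/1)=1$, and, whenever $g_\lambda$ is already defined at two consecutive Farey fractions $\frac pq<\frac rs$ (with no value yet defined strictly between them), $g_\lambda\!\left(\frac{p+r}{q+s}\right)=(1-\lambda)g_\lambda\!\left(\frac pq\right)+\lambda g_\lambda\!\left(\frac rs\right)$; it is extended to irrationals by continuity. It is continuous and strictly increasing. For $\lambda=\varphi^{-1}$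 one has, for irrational $x$, $g_{\varphi^{-1}}(x)=\sum_{i\ge1}(-1)^{i-1}\varphi^{-(S^{\varphi}_i(x)-1)}$. The derivative $g'(x)$ is the two-sided limit of $(g(x+\delta)-g(x))/\delta$ as $\delta\to0$, allowed to equal $+\infty$. *)

(* Defs.v *)
From Stdlib Require Import Reals Lra.
From Coquelicot Require Import Coquelicot.
Open Scope R_scope.

Definition phi : R := (1 + sqrt 5) / 2.
Definition kappa1 : R := 4.

Definition irrational (x : R) : Prop :=
  ~ exists (p q : Z), q <> 0%Z /\ x = IZR p / IZR q.

Definition gauss (x : R) : R := / x - IZR (floor (/ x)).

(* Partial quotients: x = [0; a_1, a_2, ...], a_n = floor(1 / T^(n-1) x), n >= 1. *)
Definition cf_digit (x : R) (n : nat) : R :=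
  IZR (floor (/ (Nat.iter (Nat.pred n) gauss x))).

Fixpoint S_phi (x : R) (t : nat) : R :=
  match t with
  | O => 0
  | S t' => S_phi x t' + cf_digit x t * (3/2 + (-1) ^ t / 2)
  end.

(* g is the Denjoy–Tichy–Uitz function g_lam: continuous on [0,1], g(0)=0, g(1)=1,
   and for every pair of consecutive Farey fractions p/q < r/s in [0,1]
   (i.e. r q - p s = 1) the value at the mediant is (1-lam) g(p/q) + lam g(r/s). *)
Definition is_DTU (lam : R) (g : R -> R) : Prop :=
  g 0 = 0 /\ g 1 = 1 /\
  (forall p q r s : nat, (0 < q)%nat -> (0 < s)%nat -> (r <= s)%nat ->
      (r * q = p * s + 1)%nat ->
      g ((INR p + INR r) / (INR q + INR s)) =
        (1 - lam) * g (INR p / INR q) + lam * g (INR r / INR s)) /\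
  (forall x, 0 <= x <= 1 -> forall eps, 0 < eps -> exists d, 0 < d /\
      forall y, 0 <= y <= 1 -> Rabs (y - x) < d -> Rabs (g y - g x) < eps).

Definition has_derivative_Rbar (g : R -> R) (x : R) (l : Rbar) : Prop :=
  is_lim (fun h => (g (x + h) - g x) / h) 0 l.

(* Main.v *)
Require Import Defs.
From Stdlib Require Import Reals Lra Lia Psatz ZArith.
From Coquelicot Require Import Coquelicot.
Open Scope R_scope.

(** The convergents $L_t = p_{2t}/q_{2t}$ and $U_t = p_{2t+1}/q_{2t+1}$ enclose [x], and each pair
    is a Farey pair, so its length is $1/(q_{2t} q_{2t+1})$, while its [g]-mass is
    $\varphi^{-(S_{2t+1}-1)}$ because $1 - \varphi^{-1} = \varphi^{-2}$: a left child keeps the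
    fraction $\varphi^{-1}$ of the mass and a right child $\varphi^{-2}$. By monotonicity, for [y]
    between consecutive $L$'s or consecutive $U$'s the difference quotient lies between
    $q_{2t} q_{2t+1} \varphi^{-S_{2t+4}-1}$ and $q_{2t+5}^2 \varphi^{-S_{2t}}$.

    Since always $q_{2t} q_{2t+1} \ge \varphi^{4t-1}$, the lower bound tends to infinity when
    $S_{2t} \le (4-\varepsilon) t$. The constant 4 is optimal because one large digit [N] costs
    [N] in the exponent $S$ but multiplies [q] only by about [N]: take all digits 1, except for
    a digit [m + k + 1] in every [m]-th block of two, with [k / m] small and
    $\varphi^k > (m+k+1)^2$. *)

(** * Farey pairs and monotonicity *)

(** The clauses are the hypotheses of the mediant rule in [is_DTU]; the determinant condition is
    additive to avoid truncated subtraction. *)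
Definition farey (p q r s : nat) : Prop :=
  (0 < q)%nat /\ (0 < s)%nat /\ (r <= s)%nat /\ (r * q = p * s + 1)%nat.

(** Taking [k] mediants at once lets one partial quotient be processed in a single step. *)
Lemma farey_left_moves (k p q r s : nat) :
  farey p q r s -> farey p q (k * p + r) (k * q + s).
Proof.
  intros (Hq & Hs & Hrs & H).
  assert (p < q)%nat by nia.
  repeat split; nia.
Qed.

Lemma farey_right_moves (k p q r s : nat) :
  farey p q r s -> farey (p + k * r) (q + k * s) r s.
Proof. intros (Hq & Hs & Hrs & H). repeat split; nia. Qed.

Lemma farey_INR (p q r s : nat) :
  farey p q r s ->
  1 <= INR q /\ 1 <= INR s /\ 0 <= INR p /\ 0 <= INR r <= INR s /\
  INR r * INR q = INR p * INR s + 1.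
Proof.
  intros (Hq & Hs & Hrs & H).
  apply (f_equal INR) in H. rewrite plus_INR, !mult_INR in H. simpl in H.
  apply le_INR in Hq, Hs, Hrs. simpl in Hq, Hs.
  pose proof (pos_INR p). pose proof (pos_INR r). tauto.
Qed.

Lemma farey_length (p q r s : nat) :
  farey p q r s -> INR r / INR s - INR p / INR q = / (INR q * INR s).
Proof.
  intros H; destruct (farey_INR _ _ _ _ H) as (Hq & Hs & Hp & Hr & E).
  apply (Rmult_eq_reg_l (INR q * INR s)); [| nra].
  transitivity (INR r * INR q - INR p * INR s); [field; lra |].
  rewrite E. field; lra.
Qed.

Lemma farey_bounds (p q r s : nat) :
  farey p q r s -> 0 <= INR p / INR q /\ INR p / INR q < INR r / INR s <= 1.
Proof.
  intros H; destruct (farey_INR _ _ _ _ H) as (Hq & Hs & Hp & Hr & E).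
  pose proof (farey_length _ _ _ _ H) as HL.
  assert (0 < / (INR q * INR s)) by (apply Rinv_0_lt_compat; nra).
  split; [apply Rdiv_le_0_compat; lra | split; [lra |]].
  apply (Rmult_le_reg_r (INR s)); [lra |]. unfold Rdiv.
  rewrite Rmult_assoc, Rinv_l by lra. lra.
Qed.

(** Follows from $(q-1)(s-1) \ge 0$. Being linear in $q+s$, the bound suits descents in which every
    mediant raises $q+s$ by at least one. *)
Lemma farey_length_le (p q r s : nat) :
  farey p q r s -> (INR q + INR s - 1) * (INR r / INR s - INR p / INR q) <= 1.
Proof.
  intros H; destruct (farey_INR _ _ _ _ H) as (Hq & Hs & Hp & Hr & E).
  rewrite (farey_length _ _ _ _ H).
  apply (Rmult_le_reg_r (INR q * INR s)); [nra |].
  rewrite Rmult_assoc, Rinv_l by nra. nra.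
Qed.

Lemma left_moves_gap (k p q r s : nat) :
  farey p q r s ->
  INR r / INR s - INR (k * p + r) / INR (k * q + s) =
  INR k / (INR s * INR (k * q + s)).
Proof.
  intros H; destruct (farey_INR _ _ _ _ H) as (Hq & Hs & Hp & Hr & E).
  rewrite !plus_INR, !mult_INR. pose proof (pos_INR k).
  assert (0 < INR k * INR q + INR s) by nra.
  replace (INR k / (INR s * (INR k * INR q + INR s)))
    with (INR k * (INR r * INR q - INR p * INR s) / (INR s * (INR k * INR q + INR s)))
    by (rewrite E; field; lra).
  field; lra.
Qed.

Lemma right_moves_gap (k p q r s : nat) :
  farey p q r s ->
  INR (p + k * r) / INR (q + k * s) - INR p / INR q =
  INR k / (INR q * INR (q + k * s)).
Proof.
  intros H; destruct (farey_INR _ _ _ _ H) as (Hq & Hs & Hp & Hr & E).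
  rewrite !plus_INR, !mult_INR. pose proof (pos_INR k).
  assert (0 < INR q + INR k * INR s) by nra.
  replace (INR k / (INR q * (INR q + INR k * INR s)))
    with (INR k * (INR r * INR q - INR p * INR s) / (INR q * (INR q + INR k * INR s)))
    by (rewrite E; field; lra).
  field; lra.
Qed.

Lemma DTU_mediant (lam : R) (g : R -> R) (p q r s : nat) :
  is_DTU lam g -> farey p q r s ->
  g (INR (p + r) / INR (q + s)) =
  (1 - lam) * g (INR p / INR q) + lam * g (INR r / INR s).
Proof.
  intros (_ & _ & Hg & _) (Hq & Hs & Hrs & H). rewrite !plus_INR. now apply Hg.
Qed.

(** Each mediant that keeps the left endpoint keeps the fraction [lam] of the mass, so [k] of them
    give a geometric factor. *)
Lemma DTU_left_moves (lam : R) (g : R -> R) (k p q r s : nat) :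
  is_DTU lam g -> farey p q r s ->
  g (INR (k * p + r) / INR (k * q + s)) - g (INR p / INR q) =
  lam ^ k * (g (INR r / INR s) - g (INR p / INR q)).
Proof.
  intros Hg HF. induction k as [| k IH]; [simpl; ring |].
  replace (S k * p + r)%nat with (p + (k * p + r))%nat by lia.
  replace (S k * q + s)%nat with (q + (k * q + s))%nat by lia.
  rewrite (DTU_mediant _ _ _ _ _ _ Hg (farey_left_moves k _ _ _ _ HF)).
  change (lam ^ S k) with (lam * lam ^ k). rewrite Rmult_assoc, <- IH. ring.
Qed.

Lemma DTU_right_moves (lam : R) (g : R -> R) (k p q r s : nat) :
  is_DTU lam g -> farey p q r s ->
  g (INR r / INR s) - g (INR (p + k * r) / INR (q + k * s)) =
  (1 - lam) ^ k * (g (INR r / INR s) - g (INR p / INR q)).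
Proof.
  intros Hg HF. induction k as [| k IH].
  - rewrite !Nat.mul_0_l, !Nat.add_0_r. simpl; ring.
  - replace (p + S k * r)%nat with ((p + k * r) + r)%nat by lia.
    replace (q + S k * s)%nat with ((q + k * s) + s)%nat by lia.
    rewrite (DTU_mediant _ _ _ _ _ _ Hg (farey_right_moves k _ _ _ _ HF)).
    change ((1 - lam) ^ S k) with ((1 - lam) * (1 - lam) ^ k).
    rewrite Rmult_assoc, <- IH. ring.
Qed.

(** Bisection at mediants, always keeping the half that contains [z]. The value at a mediant is a
    convex combination, so the values of [g] at the endpoints stay nested. *)
Lemma DTU_descent (lam : R) (g : R -> R) (p q r s : nat) (z : R) :
  0 < lam < 1 -> is_DTU lam g -> farey p q r s ->
  g (INR p / INR q) <= g (INR r / INR s) ->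
  INR p / INR q <= z <= INR r / INR s ->
  forall n : nat, exists p' q' r' s' : nat,
    farey p' q' r' s' /\ (n <= q' + s')%nat /\
    INR p' / INR q' <= z <= INR r' / INR s' /\
    g (INR p / INR q) <= g (INR p' / INR q') <= g (INR r' / INR s') /\
    g (INR r' / INR s') <= g (INR r / INR s).
Proof.
  intros Hl Hg HF Hm Hz n. induction n as [| n IH].
  - exists p, q, r, s. repeat split; try lra; try apply HF. lia.
  - destruct IH as (p' & q' & r' & s' & HF' & Hn & Hz' & H1 & H2).
    pose proof (DTU_mediant _ _ _ _ _ _ Hg HF') as Hmed.
    destruct (Rle_dec z (INR (p' + r') / INR (q' + s'))).
    + exists p', q', (p' + r')%nat, (q' + s')%nat. split; [| split; [| split; [| split]]].
      * pose proof (farey_left_moves 1 _ _ _ _ HF') as H. now rewrite !Nat.mul_1_l in H.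
      * destruct HF'; lia.
      * lra.
      * rewrite Hmed. nra.
      * rewrite Hmed. nra.
    + exists (p' + r')%nat, (q' + s')%nat, r', s'. split; [| split; [| split; [| split]]].
      * pose proof (farey_right_moves 1 _ _ _ _ HF') as H. now rewrite !Nat.mul_1_l in H.
      * destruct HF' as (? & ? & ?); lia.
      * lra.
      * rewrite Hmed. nra.
      * lra.
Qed.

(** The descent intervals shrink to [z], and continuity at [z] carries the bounds from their
    endpoints to [z]. *)
Lemma DTU_farey_between (lam : R) (g : R -> R) (p q r s : nat) (z : R) :
  0 < lam < 1 -> is_DTU lam g -> farey p q r s ->
  g (INR p / INR q) <= g (INR r / INR s) ->
  INR p / INR q <= z <= INR r / INR s ->
  g (INR p / INR q) <= g z <= g (INR r / INR s).
Proof.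
  intros Hl Hg HF Hm Hz.
  assert (H : forall eps, 0 < eps ->
    g (INR p / INR q) <= g z + eps /\ g z <= g (INR r / INR s) + eps).
  { intros eps Heps.
    destruct (farey_bounds _ _ _ _ HF) as (B1 & B2 & B3).
    pose proof (proj2 (proj2 (proj2 Hg))) as Hc.
    destruct (Hc z ltac:(lra) eps Heps) as (d & Hd & Hcd).
    (* If $q'+s'-1 > 1/d$, then [farey_length_le] makes the interval shorter than [d]. *)
    destruct (INR_unbounded (1 + / d)) as [n Hn].
    destruct (DTU_descent lam g p q r s z Hl Hg HF Hm Hz n)
      as (p' & q' & r' & s' & HF' & Hn' & Hz' & H1 & H2).
    pose proof (farey_length_le _ _ _ _ HF') as HL.
    destruct (farey_bounds _ _ _ _ HF') as (B1' & B2' & B3').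
    apply le_INR in Hn'. rewrite plus_INR in Hn'.
    assert (Hdd : / d * d = 1) by (apply Rinv_l; lra).
    assert (Rabs (g (INR p' / INR q') - g z) < eps) as K.
    { apply Hcd; [lra |]. rewrite Rabs_left1 by lra.
      assert (0 < / d) by (now apply Rinv_0_lt_compat).
      set (w := INR r' / INR s' - INR p' / INR q') in *.
      assert (w < d); [| unfold w in *; lra].
      apply Rnot_le_lt. intro. nra. }
    apply Rabs_def2 in K. lra. }
  split; apply Rnot_lt_le; intro K.
  - destruct (H ((g (INR p / INR q) - g z) / 2)); lra.
  - destruct (H ((g z - g (INR r / INR s)) / 2)); lra.
Qed.

(** Descend until a mediant falls between [u] and [v], then compare both values with the value
    there. [k] is fuel: once it is spent, the interval is too short to contain both points. *)
Lemma DTU_farey_le (lam : R) (g : R -> R) (u v : R) (k : nat) :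
  0 < lam < 1 -> is_DTU lam g -> u < v -> forall p q r s : nat, farey p q r s ->
  1 < (v - u) * (INR k + INR q + INR s - 1) ->
  g (INR p / INR q) <= g (INR r / INR s) ->
  INR p / INR q <= u -> v <= INR r / INR s -> g u <= g v.
Proof.
  intros Hl Hg Huv. induction k as [| k IH]; intros p q r s HF Hk Hm Hu Hv.
  - exfalso. pose proof (farey_length_le _ _ _ _ HF).
    destruct (farey_INR _ _ _ _ HF) as (? & ? & _). simpl in Hk. nra.
  - pose proof (DTU_mediant _ _ _ _ _ _ Hg HF) as Hmed.
    pose proof (farey_left_moves 1 _ _ _ _ HF) as HFl.
    pose proof (farey_right_moves 1 _ _ _ _ HF) as HFr.
    rewrite !Nat.mul_1_l in HFl, HFr.
    destruct (farey_INR _ _ _ _ HF) as (Hq & Hs & _).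
    rewrite S_INR in Hk.
    assert (g (INR p / INR q) <= g (INR (p + r) / INR (q + s)) <= g (INR r / INR s))
      by (rewrite Hmed; nra).
    destruct (Rle_dec v (INR (p + r) / INR (q + s))) as [Hc | Hc].
    + apply (IH _ _ _ _ HFl); try lra. rewrite plus_INR. nra.
    + destruct (Rle_dec u (INR (p + r) / INR (q + s))) as [Hc' | Hc'].
      * apply Rle_trans with (g (INR (p + r) / INR (q + s))).
        -- apply (DTU_farey_between _ _ _ _ _ _ _ Hl Hg HFl); lra.
        -- apply (DTU_farey_between _ _ _ _ _ _ _ Hl Hg HFr); lra.
      * apply (IH _ _ _ _ HFr); try lra. rewrite plus_INR. nra.
Qed.

Lemma farey_0_1 : farey 0 1 1 1.
Proof. repeat split; lia. Qed.

Lemma DTU_le (lam : R) (g : R -> R) (u v : R) :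
  0 < lam < 1 -> is_DTU lam g -> 0 <= u -> u <= v -> v <= 1 -> g u <= g v.
Proof.
  intros Hl Hg Hu [Huv | ->] Hv; [| lra].
  destruct (INR_unbounded (/ (v - u))) as [k Hk].
  assert (Hi : / (v - u) * (v - u) = 1) by (apply Rinv_l; lra).
  assert (E0 : INR 0 / INR 1 = 0) by (simpl; field).
  assert (E1 : INR 1 / INR 1 = 1) by (simpl; field).
  apply (DTU_farey_le _ _ u v k Hl Hg Huv _ _ _ _ farey_0_1); rewrite ?E0, ?E1; try lra.
  - simpl (INR 1). nra.
  - destruct Hg as (-> & -> & _). lra.
Qed.

(** * Continued fractions and convergents *)

(* Digits are indexed from 0: [a n] is the paper's $a_{n+1}$ and [X n] the n-th Gauss iterate. *)
Definition is_cf (a : nat -> nat) (X : nat -> R) : Prop :=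
  forall n, (1 <= a n)%nat /\ 0 < X n < 1 /\ / X n = INR (a n) + X (S n).

(* The pair of values of index $2t$, $2t+1$ of a solution of $c_{n+1} = a_{n+1} c_n + c_{n-1}$. *)
Fixpoint conv (a : nat -> nat) (c : nat * nat) (t : nat) : nat * nat :=
  match t with
  | O => c
  | S t' => let e := (fst (conv a c t') + a (2 * t' + 1) * snd (conv a c t'))%nat in
            (e, a (2 * t' + 2) * e + snd (conv a c t'))%nat
  end.

Definition pe (a : nat -> nat) (t : nat) : nat := fst (conv a (0, 1)%nat t).
Definition po (a : nat -> nat) (t : nat) : nat := snd (conv a (0, 1)%nat t).
Definition qe (a : nat -> nat) (t : nat) : nat := fst (conv a (1, a 0)%nat t).
Definition qo (a : nat -> nat) (t : nat) : nat := snd (conv a (1, a 0)%nat t).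

Definition lower_conv (a : nat -> nat) (t : nat) : R := INR (pe a t) / INR (qe a t).
Definition upper_conv (a : nat -> nat) (t : nat) : R := INR (po a t) / INR (qo a t).

Lemma pe_S (a : nat -> nat) (t : nat) : pe a (S t) = (pe a t + a (2 * t + 1) * po a t)%nat.
Proof. reflexivity. Qed.

Lemma qe_S (a : nat -> nat) (t : nat) : qe a (S t) = (qe a t + a (2 * t + 1) * qo a t)%nat.
Proof. reflexivity. Qed.

Lemma po_S (a : nat -> nat) (t : nat) : po a (S t) = (a (2 * t + 2) * pe a (S t) + po a t)%nat.
Proof. reflexivity. Qed.

Lemma qo_S (a : nat -> nat) (t : nat) : qo a (S t) = (a (2 * t + 2) * qe a (S t) + qo a t)%nat.
Proof. reflexivity. Qed.

Lemma farey_conv_step (a : nat -> nat) (t : nat) :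
  farey (pe a t) (qe a t) (po a t) (qo a t) ->
  farey (pe a (S t)) (qe a (S t)) (po a t) (qo a t).
Proof. rewrite pe_S, qe_S. apply farey_right_moves. Qed.

Lemma farey_conv (a : nat -> nat) (t : nat) :
  (1 <= a 0)%nat -> farey (pe a t) (qe a t) (po a t) (qo a t).
Proof.
  intros Ha. induction t as [| t IH].
  - repeat split; cbn; lia.
  - rewrite po_S, qo_S. apply farey_left_moves. now apply farey_conv_step.
Qed.

Lemma farey_conv' (a : nat -> nat) (t : nat) :
  (1 <= a 0)%nat -> farey (pe a (S t)) (qe a (S t)) (po a t) (qo a t).
Proof. intros Ha. now apply farey_conv_step, farey_conv. Qed.

(** The classical formula for $x$ in terms of two consecutive convergents and a Gauss iterate,
    cleared of denominators. *)
Lemma conv_identity (a : nat -> nat) (X : nat -> R) (t : nat) :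
  is_cf a X ->
  X 0%nat * (INR (qo a t) + X (2 * t + 1)%nat * INR (qe a t)) =
  INR (po a t) + X (2 * t + 1)%nat * INR (pe a t).
Proof.
  intros H. induction t as [| t IH].
  - destruct (H 0%nat) as (_ & HX & E). cbn in *. rewrite Rmult_1_r, <- E. field. lra.
  - rewrite po_S, qo_S, !plus_INR, !mult_INR, pe_S, qe_S, !plus_INR, !mult_INR.
    replace (2 * S t + 1)%nat with (S (2 * t + 2)) by lia.
    destruct (H (2 * t + 1)%nat) as (_ & H1 & E1).
    destruct (H (2 * t + 2)%nat) as (_ & H2 & E2).
    replace (S (2 * t + 1)) with (2 * t + 2)%nat in E1 by lia.
    set (x1 := X (2 * t + 1)%nat) in *. set (x2 := X (2 * t + 2)%nat) in *.
    replace (INR (a (2 * t + 1)%nat)) with (/ x1 - x2) by lra.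
    replace (INR (a (2 * t + 2)%nat)) with (/ x2 - X (S (2 * t + 2))) by lra.
    set (x3 := X (S (2 * t + 2))). set (x := X 0%nat) in *.
    set (P := INR (po a t)) in *. set (Q := INR (qo a t)) in *.
    set (p := INR (pe a t)) in *. set (q := INR (qe a t)) in *.
    apply Rminus_diag_uniq.
    (* With the digits eliminated, the defect of the identity at $t+1$ is its defect at $t$ divided
       by $x_1 x_2$. *)
    transitivity ((x * (Q + x1 * q) - (P + x1 * p)) / (x1 * x2)); [field; lra |].
    rewrite IH. field; lra.
Qed.

(** Here [x] is a mediant with positive real weights, hence strictly inside the interval. *)
Lemma farey_mix_between (p q r s : nat) (x c d : R) :
  farey p q r s -> 0 < c -> 0 < d ->
  x * (c * INR q + d * INR s) = c * INR p + d * INR r ->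
  INR p / INR q < x < INR r / INR s.
Proof.
  intros HF Hc Hd E.
  destruct (farey_INR _ _ _ _ HF) as (Hq & Hs & Hp & Hr & D).
  split.
  - apply Rlt_div_l; [lra |]. apply Rmult_lt_reg_r with (c * INR q + d * INR s); [nra |].
    replace (x * INR q * (c * INR q + d * INR s))
      with (INR q * (x * (c * INR q + d * INR s))) by ring.
    rewrite E. nra.
  - apply Rlt_div_r; [lra |]. apply Rmult_lt_reg_r with (c * INR q + d * INR s); [nra |].
    replace (x * INR s * (c * INR q + d * INR s))
      with (INR s * (x * (c * INR q + d * INR s))) by ring.
    rewrite E. nra.
Qed.

Lemma conv_between (a : nat -> nat) (X : nat -> R) (t : nat) :
  is_cf a X -> lower_conv a t < X 0%nat < upper_conv a t.
Proof.
  intros H. destruct (H (2 * t + 1)%nat) as (_ & HX & _).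
  apply (farey_mix_between _ _ _ _ _ (X (2 * t + 1)%nat) 1
           (farey_conv a t (proj1 (H 0%nat)))); try lra.
  rewrite !Rmult_1_l, !(Rplus_comm (_ * _)). now apply conv_identity.
Qed.

Lemma conv_INR_pos (a : nat -> nat) (t : nat) :
  (1 <= a 0)%nat -> 1 <= INR (qe a t) /\ 1 <= INR (qo a t).
Proof. intros Ha. destruct (farey_INR _ _ _ _ (farey_conv a t Ha)) as (? & ? & _). easy. Qed.

Lemma conv_gap (a : nat -> nat) (t : nat) :
  (1 <= a 0)%nat -> upper_conv a t - lower_conv a t = / (INR (qe a t) * INR (qo a t)).
Proof. intros Ha. now apply farey_length, farey_conv. Qed.

Lemma qe_le_qo (a : nat -> nat) (t : nat) :
  (forall n, 1 <= a n)%nat -> (qe a t <= qo a t)%nat.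
Proof.
  intros Ha. destruct t; [apply Ha |].
  rewrite qo_S. specialize (Ha (2 * t + 2)%nat). nia.
Qed.

(** The gap is a digit divided by two denominators, neither exceeding [qo a (S t)]. The same crude
    square also bounds the upper gap, so both sides of $x$ can be treated alike. *)
Lemma lower_conv_gap (a : nat -> nat) (t : nat) :
  (forall n, 1 <= a n)%nat ->
  / INR (qo a (S t)) ^ 2 <= lower_conv a (S t) - lower_conv a t.
Proof.
  intros Ha. unfold lower_conv. rewrite pe_S, qe_S.
  rewrite (right_moves_gap _ _ _ _ _ (farey_conv a t (Ha 0%nat))).
  rewrite <- qe_S.
  pose proof (conv_INR_pos a t (Ha 0%nat)). pose proof (conv_INR_pos a (S t) (Ha 0%nat)).
  pose proof (le_INR _ _ (qe_le_qo a (S t) Ha)).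
  pose proof (le_INR _ _ (Ha (2 * t + 1)%nat)) as Hb. simpl (INR 1) in Hb.
  assert (INR (qe a t) <= INR (qe a (S t))) by (apply le_INR; rewrite qe_S; lia).
  apply Rle_trans with (1 * / (INR (qe a t) * INR (qe a (S t)))).
  - rewrite Rmult_1_l. apply Rinv_le_contravar; nra.
  - apply Rmult_le_compat_r; [| exact Hb]. left. apply Rinv_0_lt_compat. nra.
Qed.

Lemma upper_conv_gap (a : nat -> nat) (t : nat) :
  (forall n, 1 <= a n)%nat ->
  / INR (qo a (S t)) ^ 2 <= upper_conv a t - upper_conv a (S t).
Proof.
  intros Ha. unfold upper_conv. rewrite po_S, qo_S.
  rewrite (left_moves_gap _ _ _ _ _ (farey_conv' a t (Ha 0%nat))).
  rewrite <- qo_S.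
  pose proof (conv_INR_pos a t (Ha 0%nat)). pose proof (conv_INR_pos a (S t) (Ha 0%nat)).
  pose proof (le_INR _ _ (Ha (2 * t + 2)%nat)) as Hb. simpl (INR 1) in Hb.
  assert (INR (qo a t) <= INR (qo a (S t))) by (apply le_INR; rewrite qo_S; lia).
  apply Rle_trans with (1 * / (INR (qo a t) * INR (qo a (S t)))).
  - rewrite Rmult_1_l. apply Rinv_le_contravar; nra.
  - apply Rmult_le_compat_r; [| exact Hb]. left. apply Rinv_0_lt_compat. nra.
Qed.

Lemma lower_conv_lt (a : nat -> nat) (t : nat) :
  (forall n, 1 <= a n)%nat -> lower_conv a t < lower_conv a (S t).
Proof.
  intros Ha. pose proof (lower_conv_gap a t Ha).
  pose proof (conv_INR_pos a (S t) (Ha 0%nat)).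
  assert (0 < / INR (qo a (S t)) ^ 2) by (apply Rinv_0_lt_compat; nra). lra.
Qed.

Lemma upper_conv_lt (a : nat -> nat) (t : nat) :
  (forall n, 1 <= a n)%nat -> upper_conv a (S t) < upper_conv a t.
Proof.
  intros Ha. pose proof (upper_conv_gap a t Ha).
  pose proof (conv_INR_pos a (S t) (Ha 0%nat)).
  assert (0 < / INR (qo a (S t)) ^ 2) by (apply Rinv_0_lt_compat; nra). lra.
Qed.

Lemma qe_gt (a : nat -> nat) (t : nat) : (forall n, 1 <= a n)%nat -> (t < qe a t)%nat.
Proof.
  intros Ha. induction t as [| t IH]; [cbn; lia |].
  rewrite qe_S. pose proof (qe_le_qo a t Ha). specialize (Ha (2 * t + 1)%nat). nia.
Qed.

Lemma conv_gap_small (a : nat -> nat) (d : R) :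
  (forall n, 1 <= a n)%nat -> 0 < d -> exists t, upper_conv a t - lower_conv a t < d.
Proof.
  intros Ha Hd. destruct (archimed_cor1 d Hd) as (t & Ht & Ht0).
  exists t. rewrite conv_gap by apply Ha. apply Rle_lt_trans with (/ INR t); [| exact Ht].
  pose proof (conv_INR_pos a t (Ha 0%nat)). apply lt_0_INR in Ht0.
  pose proof (lt_INR _ _ (qe_gt a t Ha)).
  apply Rinv_le_contravar; nra.
Qed.

(** The nested intervals shrink to $x$, so [y] must leave them; at the step where it does, it lies
    between two consecutive lower or two consecutive upper convergents. *)
Lemma conv_bracket (a : nat -> nat) (X : nat -> R) (t0 : nat) (y : R) :
  is_cf a X -> lower_conv a t0 < y < upper_conv a t0 -> y <> X 0%nat ->
  exists t, (t0 <= t)%nat /\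
    (lower_conv a t <= y <= lower_conv a (S t) \/ upper_conv a (S t) <= y <= upper_conv a t).
Proof.
  intros H Hy Hne.
  assert (Ha : forall n, (1 <= a n)%nat) by (intro; apply H).
  assert (Hex : forall k, (lower_conv a (k + t0) < y < upper_conv a (k + t0)) \/
    exists t, (t0 <= t)%nat /\
    (lower_conv a t <= y <= lower_conv a (S t) \/ upper_conv a (S t) <= y <= upper_conv a t)).
  { induction k as [| k [IH | IH]]; [now left | | now right].
    destruct (Rlt_dec (lower_conv a (S k + t0)) y) as [H1 | H1].
    - destruct (Rlt_dec y (upper_conv a (S k + t0))) as [H2 | H2]; [now left |].
      right. exists (k + t0)%nat. split; [lia |]. right. simpl in H2. lra.
    - right. exists (k + t0)%nat. split; [lia |]. left. simpl in H1. lra. }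
  destruct (conv_gap_small a (Rabs (y - X 0%nat)) Ha) as [t Ht];
    [apply Rabs_pos_lt; lra |].
  assert (Hmon : forall k, lower_conv a t <= lower_conv a (k + t) /\
                           upper_conv a (k + t) <= upper_conv a t).
  { induction k as [| k IH]; [simpl; lra |].
    pose proof (lower_conv_lt a (k + t) Ha). pose proof (upper_conv_lt a (k + t) Ha).
    simpl. lra. }
  (* Otherwise [y] and $x$ would share an interval shorter than their distance. *)
  destruct (Hex t) as [K | K]; [exfalso | exact K].
  specialize (Hmon t0). rewrite Nat.add_comm in Hmon.
  pose proof (conv_between a X t H).
  apply Rlt_not_le in Ht. apply Ht. apply Rabs_le. lra.
Qed.

(** * Bounds on difference quotients *)

Lemma phi_sqr : phi * phi = phi + 1.
Proof.
  unfold phi. pose proof (sqrt_sqrt 5 ltac:(lra)). nra.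
Qed.

Lemma phi_bounds : 3 / 2 < phi < 2.
Proof.
  unfold phi. pose proof (sqrt_sqrt 5 ltac:(lra)). pose proof (sqrt_pos 5). nra.
Qed.

Lemma inv_phi_bounds : 0 < / phi < 1.
Proof.
  pose proof phi_bounds. split; [apply Rinv_0_lt_compat; lra |].
  rewrite <- Rinv_1. apply Rinv_lt_contravar; lra.
Qed.

Lemma inv_phi_sqr : 1 - / phi = (/ phi) ^ 2.
Proof.
  pose proof phi_bounds. pose proof phi_sqr.
  apply (Rmult_eq_reg_l (phi * phi)); [| nra].
  transitivity (phi * phi - phi); [field; lra |].
  transitivity 1; [lra | field; lra].
Qed.

Lemma pow_phi_inv (n : nat) : phi ^ n * (/ phi) ^ n = 1.
Proof.
  pose proof phi_bounds. rewrite <- Rpow_mult_distr, Rinv_r by lra. apply pow1.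
Qed.

Lemma pow_le_1_antimono (l : R) (m n : nat) :
  0 < l < 1 -> (m <= n)%nat -> l ^ n <= l ^ m.
Proof.
  intros Hl Hmn. replace n with (m + (n - m))%nat by lia. rewrite pow_add.
  pose proof (pow_lt l m (proj1 Hl)).
  assert (l ^ (n - m) <= 1) by (rewrite <- (pow1 (n - m)); apply pow_incr; lra).
  nra.
Qed.

(* [weight a t] is $S^\varphi_{2t}$. *)
Fixpoint weight (a : nat -> nat) (t : nat) : nat :=
  match t with
  | O => O
  | S t' => (weight a t' + a (2 * t') + 2 * a (2 * t' + 1))%nat
  end.

Lemma DTU_mass_step (g : R -> R) (a : nat -> nat) (t : nat) :
  is_DTU (/ phi) g -> (1 <= a 0)%nat ->
  g (upper_conv a t) - g (lower_conv a (S t)) =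
  (/ phi) ^ (2 * a (2 * t + 1)%nat) * (g (upper_conv a t) - g (lower_conv a t)).
Proof.
  intros Hg Ha. rewrite pow_mult, <- inv_phi_sqr. unfold upper_conv, lower_conv.
  rewrite pe_S, qe_S. now apply DTU_right_moves, farey_conv.
Qed.

Lemma DTU_mass_step' (g : R -> R) (a : nat -> nat) (t : nat) :
  is_DTU (/ phi) g -> (1 <= a 0)%nat ->
  g (upper_conv a (S t)) - g (lower_conv a (S t)) =
  (/ phi) ^ a (2 * t + 2)%nat * (g (upper_conv a t) - g (lower_conv a (S t))).
Proof.
  intros Hg Ha. unfold upper_conv, lower_conv. rewrite po_S, qo_S.
  now apply DTU_left_moves, farey_conv'.
Qed.

(** The exponent on the right is $S^\varphi_{2t+1}$; the factor [/ phi] on the left replaces the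
    $-1$ in the exponent of the mass. *)
Lemma DTU_mass (g : R -> R) (a : nat -> nat) (t : nat) :
  is_DTU (/ phi) g -> (1 <= a 0)%nat ->
  / phi * (g (upper_conv a t) - g (lower_conv a t)) = (/ phi) ^ (weight a t + a (2 * t)%nat).
Proof.
  intros Hg Ha. induction t as [| t IH].
  (* The first interval $[0, 1/a_1]$ arises from $[0,1]$ by $a_1 - 1$ left moves. *)
  - pose proof (DTU_left_moves _ g (a 0 - 1)%nat _ _ _ _ Hg farey_0_1) as H.
    replace ((a 0 - 1) * 0 + 1)%nat with 1%nat in H by lia.
    replace ((a 0 - 1) * 1 + 1)%nat with (a 0)%nat in H by lia.
    unfold upper_conv, lower_conv, pe, po, qe, qo; cbn [conv fst snd].
    rewrite H.
    replace (INR 0 / INR 1) with 0 by (simpl; field).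
    replace (INR 1 / INR 1) with 1 by (simpl; field).
    destruct Hg as (-> & -> & _).
    cbn [weight Nat.mul Nat.add].
    replace (a 0%nat) with (S (a 0%nat - 1)) at 2 by lia. simpl pow. ring.
  - replace (2 * S t)%nat with (2 * t + 2)%nat by lia.
    rewrite DTU_mass_step', DTU_mass_step by assumption.
    transitivity ((/ phi) ^ a (2 * t + 2)%nat * (/ phi) ^ (2 * a (2 * t + 1)%nat) *
      (/ phi * (g (upper_conv a t) - g (lower_conv a t)))); [ring |].
    rewrite IH, <- !pow_add. f_equal. cbn [weight]. lia.
Qed.

(** The jump is the fraction $1 - \varphi^{-2a} \ge 1 - \varphi^{-2} = \varphi^{-1}$ of the mass
    given by [DTU_mass]. *)
Lemma DTU_lower_jump (g : R -> R) (a : nat -> nat) (t : nat) :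
  is_DTU (/ phi) g -> (forall n, 1 <= a n)%nat ->
  (/ phi) ^ (weight a (S t) + 1) <= g (lower_conv a (S t)) - g (lower_conv a t).
Proof.
  intros Hg Ha. pose proof (DTU_mass g a t Hg (Ha 0%nat)) as HM.
  pose proof (DTU_mass_step g a t Hg (Ha 0%nat)) as HS.
  pose proof inv_phi_bounds as Hl. pose proof inv_phi_sqr as Hl2.
  pose proof (pow_le_1_antimono _ 2 (2 * a (2 * t + 1)%nat) Hl
                ltac:(specialize (Ha (2 * t + 1)%nat); lia)) as H1.
  pose proof (pow_le_1_antimono _ (weight a t + a (2 * t)%nat) (weight a (S t) + 1) Hl
                ltac:(cbn [weight]; lia)) as H2.
  set (D := g (upper_conv a t) - g (lower_conv a t)) in *.
  set (w := (/ phi) ^ (2 * a (2 * t + 1)%nat)) in *.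
  assert (0 < (/ phi) ^ (weight a t + a (2 * t)%nat)) by (apply pow_lt; lra).
  assert (0 < D) by nra.
  replace (g (lower_conv a (S t)) - g (lower_conv a t)) with ((1 - w) * D)
    by (unfold D in *; lra).
  nra.
Qed.

(** Now the fraction is only $1 - \varphi^{-a} \ge \varphi^{-2}$, of a mass $\varphi^{1 -
    S_{2t+2}}$; this side dictates the common exponent [weight a (S t) + 1]. *)
Lemma DTU_upper_jump (g : R -> R) (a : nat -> nat) (t : nat) :
  is_DTU (/ phi) g -> (forall n, 1 <= a n)%nat ->
  (/ phi) ^ (weight a (S t) + 1) <= g (upper_conv a t) - g (upper_conv a (S t)).
Proof.
  intros Hg Ha. pose proof (DTU_mass g a t Hg (Ha 0%nat)) as HM.
  pose proof (DTU_mass_step g a t Hg (Ha 0%nat)) as HS.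
  pose proof inv_phi_bounds as Hl. pose proof inv_phi_sqr as Hl2.
  pose proof (DTU_mass_step' g a t Hg (Ha 0%nat)) as HS'.
  pose proof (pow_le_1_antimono _ 1 (a (2 * t + 2)%nat) Hl (Ha _)) as H1.
  rewrite pow_1 in H1.
  set (w := (/ phi) ^ a (2 * t + 2)%nat) in *.
  set (D := g (upper_conv a t) - g (lower_conv a (S t))) in *.
  assert (E : / phi * D = (/ phi) ^ (weight a (S t))).
  { rewrite HS.
    transitivity ((/ phi) ^ (2 * a (2 * t + 1)%nat) *
      (/ phi * (g (upper_conv a t) - g (lower_conv a t)))); [ring |].
    rewrite HM, <- !pow_add. f_equal. cbn [weight]. lia. }
  assert (0 < (/ phi) ^ (weight a (S t))) by (apply pow_lt; lra).
  replace (g (upper_conv a t) - g (upper_conv a (S t))) with ((1 - w) * D)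
    by (unfold D in *; lra).
  rewrite pow_add, pow_1, <- E.
  assert (0 < D) by nra. simpl pow in Hl2. nra.
Qed.

Lemma Rdiv_bounds (m ml mh d dl dh : R) :
  0 <= ml <= m -> m <= mh -> 0 < dl <= d -> d <= dh -> ml * / dh <= m / d <= mh * / dl.
Proof.
  intros. split; apply Rmult_le_compat; try lra;
    try (left; apply Rinv_0_lt_compat; lra); apply Rinv_le_contravar; lra.
Qed.

(** Both $x$ and [y] lie in the interval of index [t], which bounds both increments from above. On
    the side of [y], the convergents of indices $t+1$ and $t+2$ separate [y] from $x$, which bounds
    both from below. *)
Lemma DTU_slope_bounds (g : R -> R) (a : nat -> nat) (X : nat -> R) (t : nat) (y : R) :
  is_DTU (/ phi) g -> is_cf a X ->
  lower_conv a t <= y <= lower_conv a (S t) \/ upper_conv a (S t) <= y <= upper_conv a t ->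
  (/ phi) ^ (weight a (t + 2) + 1) * (INR (qe a t) * INR (qo a t)) <=
  (g y - g (X 0%nat)) / (y - X 0%nat) <= (/ phi) ^ weight a t * INR (qo a (t + 2)) ^ 2.
Proof.
  intros Hg H Hy.
  assert (Ha : forall n, (1 <= a n)%nat) by (intro; apply H).
  pose proof inv_phi_bounds as Hl.
  replace (t + 2)%nat with (S (S t)) by lia.
  assert (Hpos : 0 < INR (qe a t) * INR (qo a t) /\ 0 < INR (qo a (S (S t))) ^ 2).
  { pose proof (conv_INR_pos a t (Ha 0%nat)). pose proof (conv_INR_pos a (S (S t)) (Ha 0%nat)).
    nra. }
  pose proof (conv_gap a t (Ha 0%nat)) as G.
  pose proof (farey_bounds _ _ _ _ (farey_conv a t (Ha 0%nat))) as F.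
  change (0 <= lower_conv a t /\ lower_conv a t < upper_conv a t <= 1) in F.
  pose proof (conv_between a X t H). pose proof (conv_between a X (S t) H).
  pose proof (conv_between a X (S (S t)) H).
  pose proof (lower_conv_lt a t Ha). pose proof (upper_conv_lt a t Ha).
  pose proof (lower_conv_lt a (S t) Ha). pose proof (upper_conv_lt a (S t) Ha).
  pose proof (lower_conv_gap a (S t) Ha). pose proof (upper_conv_gap a (S t) Ha).
  pose proof (DTU_lower_jump g a (S t) Hg Ha). pose proof (DTU_upper_jump g a (S t) Hg Ha).
  assert (HM : g (upper_conv a t) - g (lower_conv a t) <= (/ phi) ^ weight a t).
  { apply (Rmult_le_reg_l (/ phi)); [lra |].
    rewrite DTU_mass by (auto; apply Ha).
    change (/ phi * (/ phi) ^ weight a t) with ((/ phi) ^ (S (weight a t))).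
    apply pow_le_1_antimono; [lra |]. specialize (Ha (2 * t)%nat). lia. }
  assert (Hmono : forall u v, 0 <= u -> u <= v -> v <= 1 -> g u <= g v)
    by (intros; now apply (DTU_le (/ phi))).
  (* Products become inverses of lengths, to match [Rdiv_bounds]. *)
  rewrite <- (Rinv_inv (INR (qe a t) * INR (qo a t))),
          <- (Rinv_inv (INR (qo a (S (S t))) ^ 2)).
  assert (0 <= (/ phi) ^ (weight a (S (S t)) + 1)) by (apply pow_le; lra).
  assert (0 < / INR (qo a (S (S t))) ^ 2) by (apply Rinv_0_lt_compat; lra).
  set (x := X 0%nat) in *.
  pose proof (Hmono (lower_conv a t) x ltac:(lra) ltac:(lra) ltac:(lra)).
  pose proof (Hmono x (upper_conv a t) ltac:(lra) ltac:(lra) ltac:(lra)).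
  destruct Hy as [Hy | Hy].
  - replace ((g y - g x) / (y - x)) with ((g x - g y) / (x - y)) by (field; lra).
    pose proof (Hmono (lower_conv a t) y ltac:(lra) ltac:(lra) ltac:(lra)).
    pose proof (Hmono y (lower_conv a (S t)) ltac:(lra) ltac:(lra) ltac:(lra)).
    pose proof (Hmono (lower_conv a (S (S t))) x ltac:(lra) ltac:(lra) ltac:(lra)).
    apply Rdiv_bounds; lra.
  - pose proof (Hmono (upper_conv a (S t)) y ltac:(lra) ltac:(lra) ltac:(lra)).
    pose proof (Hmono y (upper_conv a t) ltac:(lra) ltac:(lra) ltac:(lra)).
    pose proof (Hmono x (upper_conv a (S (S t))) ltac:(lra) ltac:(lra) ltac:(lra)).
    apply Rdiv_bounds; lra.
Qed.

(** * Growth of the denominators *)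

(** Digits 1 are the slowest case, and there $\varphi^2 = \varphi + 1$ drives the induction. The
    factor [phi] avoids the exponent $2t-1$. *)
Lemma conv_growth (a : nat -> nat) (t : nat) :
  (forall n, 1 <= a n)%nat ->
  phi ^ (2 * t) <= phi * INR (qe a t) /\ phi ^ (2 * t) <= INR (qo a t).
Proof.
  intros Ha. pose proof phi_bounds. pose proof phi_sqr as Hs.
  induction t as [| t [IH1 IH2]].
  - unfold qe, qo. cbn [conv fst snd]. pose proof (le_INR _ _ (Ha 0%nat)).
    simpl in *. lra.
  - pose proof (le_INR _ _ (Ha (2 * t + 1)%nat)) as H1.
    pose proof (le_INR _ _ (Ha (2 * t + 2)%nat)) as H2. simpl (INR 1) in *.
    pose proof (conv_INR_pos a t (Ha 0%nat)).
    pose proof (conv_INR_pos a (S t) (Ha 0%nat)).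
    replace (2 * S t)%nat with (S (S (2 * t))) by lia.
    change (phi ^ S (S (2 * t))) with (phi * (phi * phi ^ (2 * t))).
    rewrite <- Rmult_assoc, Hs.
    assert (K : (phi + 1) * phi ^ (2 * t) <= phi * INR (qe a (S t))).
    { rewrite qe_S, plus_INR, mult_INR.
      apply Rle_trans with (phi * (INR (qe a t) + 1 * INR (qo a t))); [nra |].
      apply Rmult_le_compat_l; [lra |]. nra. }
    split; [exact K |]. rewrite qo_S, plus_INR, mult_INR.
    assert (phi * phi ^ (2 * t) <= INR (qe a (S t))); [| nra].
    apply (Rmult_le_reg_l phi); [lra |]. rewrite <- Rmult_assoc, Hs. lra.
Qed.

Fixpoint digit_prod (a : nat -> nat) (t : nat) : nat :=
  match t with
  | O => 1%nat
  | S t' => (digit_prod a t' * a (2 * t'))%nat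
  end.

(* With even-indexed digits equal to 1, a block $(1,a)$ acts on $(q_{2t}, q_{2t+1})$, and
   $q_{2t} + \varphi q_{2t+1}$ is an eigenform of the block $(1,1)$ for the eigenvalue $\varphi^2$. *)
Lemma conv_growth_le (a : nat -> nat) (t : nat) :
  (forall n, 1 <= a n)%nat -> (forall i, a (2 * i + 1) = 1)%nat ->
  INR (qe a t) + phi * INR (qo a t) <= phi ^ (2 * t + 2) * INR (digit_prod a (S t)).
Proof.
  intros Ha Hb. pose proof phi_bounds. pose proof phi_sqr as Hs.
  induction t as [| t IH].
  - unfold qe, qo. cbn [conv fst snd digit_prod]. pose proof (le_INR _ _ (Ha 0%nat)) as H0.
    rewrite mult_INR. cbn [Nat.mul Nat.add]. simpl pow. simpl (INR 1) in *.
    rewrite Rmult_1_r, Hs. nra.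
  - pose proof (le_INR _ _ (Ha (2 * t + 2)%nat)) as H2. simpl (INR 1) in *.
    pose proof (conv_INR_pos a t (Ha 0%nat)).
    change (digit_prod a (S (S t))) with (digit_prod a (S t) * a (2 * S t))%nat.
    replace (2 * S t)%nat with (2 * t + 2)%nat by lia.
    rewrite qo_S, plus_INR, mult_INR, qe_S, plus_INR, mult_INR, Hb, mult_INR.
    simpl (INR 1).
    rewrite (pow_add phi (2 * t + 2)). simpl (phi ^ 2). rewrite Rmult_1_r, Hs.
    set (A := INR (a (2 * t + 2)%nat)) in *. set (q := INR (qe a t)) in *.
    set (Q := INR (qo a t)) in *. set (Z := phi ^ (2 * t + 2)) in *.
    set (W := INR (digit_prod a (S t))) in *.
    (* Equality holds for $A = 1$ by the eigenform property; in general the excess is $(A-1)(q +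
       (\varphi+1)Q) \ge 0$. *)
    apply Rle_trans with ((phi + 1) * A * (q + phi * Q)).
    + replace ((phi + 1) * A * (q + phi * Q)) with (A * ((phi + 1) * q + (2 * phi + 1) * Q)).
      * assert (0 <= (A - 1) * q) by nra. assert (0 <= (A - 1) * Q) by nra.
        assert (0 <= phi * ((A - 1) * Q)) by nra. lra.
      * replace (2 * phi + 1) with (phi * phi + phi) by lra. ring.
    + assert (0 <= (phi + 1) * A) by nra. nra.
Qed.

(** * Gauss iterates *)

Lemma floor_spec (x : R) : IZR (floor x) <= x < IZR (floor x) + 1.
Proof. unfold floor. now destruct (floor_ex x). Qed.

Lemma floor_unique (x : R) (n : Z) : IZR n <= x < IZR n + 1 -> floor x = n.
Proof.
  intros H. pose proof (floor_spec x).
  assert (floor x < n + 1)%Z by (apply lt_IZR; rewrite plus_IZR; lra).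
  assert (n < floor x + 1)%Z by (apply lt_IZR; rewrite plus_IZR; lra). lia.
Qed.

Lemma irrational_gauss (x : R) :
  0 < x < 1 -> irrational x -> 0 < gauss x < 1 /\ irrational (gauss x).
Proof.
  intros Hx Hi. pose proof (floor_spec (/ x)) as Hf. unfold gauss.
  set (n := floor (/ x)) in *.
  assert (Hn : irrational (/ x - IZR n)).
  { intros (p & q & Hq & E). apply Hi. exists q, (p + n * q)%Z.
    assert (IZR q <> 0) by (now apply not_0_IZR).
    assert (E' : / x = IZR (p + n * q) / IZR q).
    { rewrite plus_IZR, mult_IZR.
      replace ((IZR p + IZR n * IZR q) / IZR q) with (IZR p / IZR q + IZR n)
        by (field; lra). lra. }
    assert (0 < / x) by (apply Rinv_0_lt_compat; lra).
    assert (IZR (p + n * q) <> 0) by (intro K; rewrite K in E'; unfold Rdiv in E'; lra).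
    split; [intro K; apply H1; now rewrite K |].
    rewrite <- (Rinv_inv x), E'. field; lra. }
  split; [| exact Hn].
  destruct (Req_dec (/ x - IZR n) 0) as [K | K]; [| lra].
  exfalso. apply Hn. exists 0%Z, 1%Z. split; [lia |]. rewrite K. field.
Qed.

Lemma is_cf_gauss (x : R) :
  0 < x < 1 -> irrational x ->
  is_cf (fun n => Z.to_nat (floor (/ Nat.iter n gauss x))) (fun n => Nat.iter n gauss x).
Proof.
  intros Hx Hi n.
  assert (H : 0 < Nat.iter n gauss x < 1 /\ irrational (Nat.iter n gauss x)).
  { induction n as [| n IH]; [now split |]. simpl. now apply irrational_gauss. }
  destruct H as [H _].
  change (Nat.iter (S n) gauss x) with (gauss (Nat.iter n gauss x)).
  set (z := Nat.iter n gauss x) in *. unfold gauss.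
  pose proof (floor_spec (/ z)).
  assert (1 < / z) by (rewrite <- Rinv_1; apply Rinv_lt_contravar; lra).
  (* Positivity makes [Z.to_nat] lossless. *)
  assert (0 < floor (/ z))%Z by (apply lt_IZR; lra).
  split; [lia | split; [easy |]].
  rewrite INR_IZR_INZ, Z2Nat.id by lia. ring.
Qed.

Lemma is_cf_floor (a : nat -> nat) (X : nat -> R) (n : nat) :
  is_cf a X -> floor (/ X n) = Z.of_nat (a n).
Proof.
  intros H. destruct (H n) as (_ & _ & E). destruct (H (S n)) as (_ & HX & _).
  apply floor_unique. rewrite E, <- INR_IZR_INZ. lra.
Qed.

Lemma is_cf_iter (a : nat -> nat) (X : nat -> R) (n : nat) :
  is_cf a X -> Nat.iter n gauss (X 0%nat) = X n.
Proof.
  intros H. induction n as [| n IH]; [reflexivity |].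
  simpl. rewrite IH. unfold gauss. rewrite (is_cf_floor a X n H), <- INR_IZR_INZ.
  destruct (H n) as (_ & _ & E). lra.
Qed.

Lemma is_cf_S_phi (a : nat -> nat) (X : nat -> R) (t : nat) :
  is_cf a X -> S_phi (X 0%nat) (2 * t) = INR (weight a t).
Proof.
  intros H.
  assert (Hd : forall n, cf_digit (X 0%nat) (S n) = INR (a n)).
  { intros n. unfold cf_digit. rewrite Nat.pred_succ, (is_cf_iter a X n H),
      (is_cf_floor a X n H). now rewrite <- INR_IZR_INZ. }
  induction t as [| t IH]; [reflexivity |].
  replace (2 * S t)%nat with (S (S (2 * t))) by lia. cbn [S_phi weight].
  rewrite IH, !Hd, !plus_INR, mult_INR.
  replace (2 * t + 1)%nat with (S (2 * t)) by lia.
  change ((-1) ^ S (S (2 * t))) with (-1 * (-1 * (-1) ^ (2 * t))).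
  change ((-1) ^ S (2 * t)) with (-1 * (-1) ^ (2 * t)).
  rewrite pow_1_even. simpl (INR 2). lra.
Qed.

(** Infinite descent: if $X_n = p/q$ lies in $(0,1)$, then $X_{n+1}$ has the smaller denominator
    $p$. *)
Lemma is_cf_irrational (a : nat -> nat) (X : nat -> R) : is_cf a X -> irrational (X 0%nat).
Proof.
  intros H.
  assert (D : forall d n p q, (0 < q < Z.of_nat d)%Z -> X n <> IZR p / IZR q).
  { induction d as [| d IH]; intros n p q Hq E; [lia |].
    destruct (H n) as (_ & HX & Ex).
    assert (Hq0 : 0 < IZR q) by (apply IZR_lt; lia).
    assert (Hp : IZR p = X n * IZR q) by (rewrite E; field; lra).
    assert (Hp0 : 0 < IZR p < IZR q) by nra.
    destruct Hp0 as [Hp0 Hpq]. pose proof (lt_IZR _ _ Hp0). pose proof (lt_IZR _ _ Hpq).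
    apply (IH (S n) (q - Z.of_nat (a n) * p)%Z p); [lia |].
    rewrite minus_IZR, mult_IZR, <- INR_IZR_INZ.
    replace (X (S n)) with (/ X n - INR (a n)) by lra. rewrite E. field; lra. }
  intros (p & q & Hq & E).
  destruct (Z_lt_le_dec 0 q) as [Hq' | Hq'].
  - apply (D (S (Z.to_nat q)) 0%nat p q); [lia | exact E].
  - apply (D (S (Z.to_nat (- q))) 0%nat (- p)%Z (- q)%Z); [lia |].
    rewrite E, !opp_IZR. field. now apply not_0_IZR.
Qed.

(** * Continued fractions with prescribed digits *)

(** The finite continued fraction with the [k] digits starting at [a n]. The start varies because
    the limits over [k] are to be the Gauss iterates. *)
Fixpoint cf_trunc (a : nat -> nat) (n k : nat) : R :=
  match k with
  | O => 0
  | S k' => / (INR (a n) + cf_trunc a (S n) k')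
  end.

Lemma cf_trunc_bounds (a : nat -> nat) (n k : nat) :
  (forall n, 1 <= a n)%nat -> 0 <= cf_trunc a n k <= 1.
Proof.
  intros Ha. revert n. induction k as [| k IH]; intros n; simpl; [lra |].
  specialize (IH (S n)). pose proof (le_INR _ _ (Ha n)) as H. simpl (INR 1) in H.
  split; [left; apply Rinv_0_lt_compat; lra |].
  rewrite <- Rinv_1. apply Rinv_le_contravar; lra.
Qed.

(* Two steps of $x \mapsto 1/(a+x)$ contract by 4, whereas a single one need not contract. *)
Lemma cf_step_contract (a b x y : R) :
  1 <= a -> 1 <= b -> 0 <= x -> 0 <= y ->
  Rabs (/ (a + / (b + x)) - / (a + / (b + y))) <= / 4 * Rabs (x - y).
Proof.
  intros Ha Hb Hx Hy.
  assert (2 <= a * (b + x) + 1) by nra. assert (2 <= a * (b + y) + 1) by nra.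
  replace (/ (a + / (b + x)) - / (a + / (b + y)))
    with (/ ((a * (b + x) + 1) * (a * (b + y) + 1)) * (x - y))
    by (field; repeat split; nra).
  rewrite Rabs_mult. apply Rmult_le_compat_r; [apply Rabs_pos |].
  rewrite Rabs_pos_eq by (left; apply Rinv_0_lt_compat; nra).
  apply Rinv_le_contravar; nra.
Qed.

Lemma cf_trunc_cauchy (a : nat -> nat) (k i j n : nat) :
  (forall n, 1 <= a n)%nat ->
  Rabs (cf_trunc a n (2 * k + i) - cf_trunc a n (2 * k + j)) <= (/ 4) ^ k.
Proof.
  intros Ha. revert n. induction k as [| k IH]; intros n.
  - pose proof (cf_trunc_bounds a n i Ha). pose proof (cf_trunc_bounds a n j Ha).
    simpl. apply Rabs_le. lra.
  - replace (2 * S k + i)%nat with (S (S (2 * k + i))) by lia.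
    replace (2 * S k + j)%nat with (S (S (2 * k + j))) by lia.
    cbn [cf_trunc].
    pose proof (cf_trunc_bounds a (S (S n)) (2 * k + i) Ha).
    pose proof (cf_trunc_bounds a (S (S n)) (2 * k + j) Ha).
    pose proof (le_INR _ _ (Ha n)) as H1. pose proof (le_INR _ _ (Ha (S n))) as H2.
    simpl (INR 1) in *.
    eapply Rle_trans; [apply cf_step_contract; lra |].
    specialize (IH (S (S n))). cbn [pow]. lra.
Qed.

Lemma cf_trunc_lim (a : nat -> nat) (n : nat) :
  (forall n, 1 <= a n)%nat -> ex_finite_lim_seq (cf_trunc a n).
Proof.
  intros Ha. apply ex_lim_seq_cauchy_corr. intros eps.
  destruct (pow_lt_1_zero (/ 4) ltac:(rewrite Rabs_pos_eq; lra) eps (cond_pos eps)) as [k Hk].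
  exists (2 * k)%nat. intros i j Hi Hj.
  replace i with (2 * k + (i - 2 * k))%nat by lia.
  replace j with (2 * k + (j - 2 * k))%nat by lia.
  eapply Rle_lt_trans; [now apply cf_trunc_cauchy |].
  specialize (Hk k (le_n k)). rewrite Rabs_pos_eq in Hk; [exact Hk |].
  apply pow_le; lra.
Qed.

(** Passing to the limit in the recursion of [cf_trunc] gives [HE], the defining relation between
    consecutive iterates. *)
Lemma is_cf_exists (a : nat -> nat) : (forall n, 1 <= a n)%nat -> exists X, is_cf a X.
Proof.
  intros Ha. exists (fun n => real (Lim_seq (cf_trunc a n))).
  set (X := fun n => real (Lim_seq (cf_trunc a n))).
  assert (HX : forall n, is_lim_seq (cf_trunc a n) (X n)).
  { intros n. apply Lim_seq_correct', cf_trunc_lim, Ha. }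
  assert (H0 : forall n, 0 <= X n).
  { intros n. apply (is_lim_seq_le (fun _ => 0) (cf_trunc a n) 0 (X n));
      [intro; now apply cf_trunc_bounds | apply is_lim_seq_const | apply HX]. }
  assert (H1 : forall n, 1 <= INR (a n)).
  { intros n. exact (le_INR _ _ (Ha n)). }
  assert (HE : forall n, X n = / (INR (a n) + X (S n))).
  { intros n. specialize (H0 (S n)). specialize (H1 n).
    assert (K : is_lim_seq (fun k => cf_trunc a n (S k)) (/ (INR (a n) + X (S n)))).
    { simpl cf_trunc.
      apply (is_lim_seq_inv _ (INR (a n) + X (S n))).
      - apply is_lim_seq_plus'; [apply is_lim_seq_const | apply HX].
      - intro K. injection K. lra. }
    apply is_lim_seq_incr_1 in K.
    apply is_lim_seq_unique in K. unfold X at 1. now rewrite K. }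
  assert (Hp : forall n, 0 < X n).
  { intros n. rewrite HE. specialize (H0 (S n)). specialize (H1 n).
    apply Rinv_0_lt_compat. lra. }
  intros n.  fold (X n) (X (S n)). split; [apply Ha |]. split; [split; [apply Hp |] |].
  - rewrite HE. specialize (Hp (S n)). specialize (H1 n).
    rewrite <- Rinv_1. apply Rinv_lt_contravar; lra.
  - rewrite (HE n). now rewrite Rinv_inv.
Qed.

(** * Derivatives *)

(** Reduces both derivative claims to [DTU_slope_bounds]: every point near $x$ is bracketed at some
    index at least [t0]. *)
Lemma slope_near (g : R -> R) (a : nat -> nat) (X : nat -> R) (P : R -> Prop) (t0 : nat) :
  is_cf a X ->
  (forall t y, (t0 <= t)%nat ->
    lower_conv a t <= y <= lower_conv a (S t) \/ upper_conv a (S t) <= y <= upper_conv a t ->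
    P ((g y - g (X 0%nat)) / (y - X 0%nat))) ->
  Rbar_locally' 0 (fun h => P ((g (X 0%nat + h) - g (X 0%nat)) / h)).
Proof.
  intros H HP. pose proof (conv_between a X t0 H) as Hb.
  assert (Hd : 0 < Rmin (X 0%nat - lower_conv a t0) (upper_conv a t0 - X 0%nat))
    by (apply Rmin_pos; lra).
  exists (mkposreal _ Hd). intros h Hh Hne.
  change (Rabs (h - 0) < Rmin (X 0%nat - lower_conv a t0) (upper_conv a t0 - X 0%nat)) in Hh.
  rewrite Rminus_0_r in Hh.
  pose proof (Rmin_l (X 0%nat - lower_conv a t0) (upper_conv a t0 - X 0%nat)).
  pose proof (Rmin_r (X 0%nat - lower_conv a t0) (upper_conv a t0 - X 0%nat)).
  apply Rabs_def2 in Hh.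
  destruct (conv_bracket a X t0 (X 0%nat + h) H ltac:(lra) ltac:(lra)) as (t & Ht & Hy).
  specialize (HP t _ Ht Hy). now replace (X 0%nat + h - X 0%nat) with h in HP by (simpl; lra).
Qed.

Lemma LimSup_seq_lt (u : nat -> R) (l : R) :
  Rbar_lt (LimSup_seq u) l ->
  exists (c : R) (N : nat), c < l /\ forall n, (N <= n)%nat -> u n < c.
Proof.
  unfold LimSup_seq. destruct (ex_LimSup_seq u) as [[r | |] H]; simpl; intros Hl.
  - assert (He : 0 < (l - r) / 2) by lra.
    destruct (H (mkposreal _ He)) as [_ [N HN]]. simpl in HN.
    exists (r + (l - r) / 2), N. split; [lra | exact HN].
  - easy.
  - destruct (H (l - 1)) as [N HN]. exists (l - 1), N. split; [lra | exact HN].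
Qed.

Lemma DTU_derivative_infinite (g : R -> R) (a : nat -> nat) (X : nat -> R) (c : R) (N : nat) :
  is_DTU (/ phi) g -> is_cf a X -> c < 4 ->
  (forall t, (N <= t)%nat -> INR (weight a t) / INR t < c) ->
  has_derivative_Rbar g (X 0%nat) p_infty.
Proof.
  intros Hg H Hc HN. apply is_lim_spec. intros M.
  assert (Ha : forall n, (1 <= a n)%nat) by (intro; apply H).
  pose proof phi_bounds as Hphi.
  destruct (Pow_x_infinity phi ltac:(rewrite Rabs_pos_eq; lra) (Rmax 0 M + 1)) as [K HK].
  specialize (HK K (le_n K)). rewrite Rabs_pos_eq in HK by (apply pow_le; lra).
  pose proof (Rmax_r 0 M).
  (* The weight at $t+2$ is below $ct + 2c \le ct + 8$; with the 3 in [Hw] this makes 11. *)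
  destruct (INR_unbounded ((INR K + 11) / (4 - c))) as [T HT].
  apply (slope_near g a X (fun z => M < z) (N + T) H).
  intros t y Ht Hy.
  destruct (DTU_slope_bounds g a X t y Hg H Hy) as [Hlow _].
  eapply Rlt_le_trans; [| exact Hlow].
  assert (HtT : INR T <= INR t) by (apply le_INR; lia).
  assert (Hw : (weight a (t + 2) + K + 3 <= 4 * t)%nat).
  { apply INR_le. specialize (HN (t + 2)%nat ltac:(lia)).
    pose proof (pos_INR t).
    rewrite !plus_INR, mult_INR in *. simpl (INR 2) in HN. simpl (INR 3). simpl (INR 4).
    apply Rlt_div_l in HN; [| lra].
    assert (INR K + 11 < INR t * (4 - c)) by (apply Rlt_div_l; lra). lra. }
  destruct (conv_growth a t Ha) as [G1 G2].
  pose proof inv_phi_bounds as Hl.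
  set (w := weight a (t + 2)) in *.
  assert (P1 : phi ^ (4 * t) <= phi * (INR (qe a t) * INR (qo a t))).
  { replace (4 * t)%nat with (2 * t + 2 * t)%nat by lia. rewrite pow_add, <- Rmult_assoc.
    apply Rmult_le_compat; try assumption; apply pow_le; lra. }
  assert (P2 : phi ^ (w + 1) * phi ^ (K + 2) <= phi ^ (4 * t)).
  { rewrite <- pow_add. apply Rle_pow; [lra | lia]. }
  assert (P3 : 0 < (/ phi) ^ (w + 1)) by (apply pow_lt; lra).
  pose proof (pow_phi_inv (w + 1)) as E.
  (* One of the two spare powers pays for the factor [phi]; the rest exceeds [M] by the choice of
     [K]. *)
  assert (P4 : phi ^ (K + 2) <= phi * ((/ phi) ^ (w + 1) * (INR (qe a t) * INR (qo a t)))).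
  { replace (phi ^ (K + 2)) with ((/ phi) ^ (w + 1) * (phi ^ (w + 1) * phi ^ (K + 2)))
      by (rewrite <- Rmult_assoc, (Rmult_comm ((/ phi) ^ _)), E; ring).
    replace (phi * ((/ phi) ^ (w + 1) * (INR (qe a t) * INR (qo a t))))
      with ((/ phi) ^ (w + 1) * (phi * (INR (qe a t) * INR (qo a t)))) by ring.
    apply Rmult_le_compat_l; lra. }
  rewrite pow_add in P4. simpl (phi ^ 2) in P4.
  apply (Rmult_lt_reg_l phi); [lra |]. eapply Rlt_le_trans; [| exact P4].
  replace (phi ^ K * (phi * (phi * 1))) with (phi * (phi ^ K * phi)) by ring.
  apply Rmult_lt_compat_l; [lra |].
  pose proof (Rmax_l 0 M). nra.
Qed.

(** * Sparse large digits and derivative zero *)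

(** For $m \ge 1$, the digit at $2i$ is [N] exactly when [m] divides $i+1$. Testing whether the
    quotient by [m] jumps makes the number of large digits telescope to [t / m]. *)
Definition sparse_digits (m N : nat) (n : nat) : nat :=
  if Nat.even n then (if Nat.eqb (S (n / 2) / m) (n / 2 / m) then 1 else N)%nat else 1%nat.

Lemma sparse_digits_pos (m N n : nat) : (1 <= N)%nat -> (1 <= sparse_digits m N n)%nat.
Proof.
  intros. unfold sparse_digits. destruct (Nat.even n); [destruct Nat.eqb |]; lia.
Qed.

Lemma sparse_digits_odd (m N i : nat) : sparse_digits m N (2 * i + 1) = 1%nat.
Proof. unfold sparse_digits. now rewrite Nat.even_odd. Qed.

Lemma sparse_digits_even (m N i : nat) :
  sparse_digits m N (2 * i) = if Nat.eqb (S i / m) (i / m) then 1%nat else N.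
Proof.
  unfold sparse_digits. rewrite Nat.even_even.
  now replace (2 * i / 2)%nat with i by (rewrite Nat.mul_comm, Nat.div_mul; lia).
Qed.

Lemma div_succ (m i : nat) :
  (1 <= m)%nat -> (S i / m = i / m \/ S i / m = S (i / m))%nat.
Proof.
  intros Hm.
  assert (i / m <= S i / m)%nat by (apply Nat.Div0.div_le_mono; lia).
  assert (S i / m <= (i + 1 * m) / m)%nat by (apply Nat.Div0.div_le_mono; lia).
  rewrite Nat.div_add in * by lia. lia.
Qed.

Lemma sparse_digits_weight (m N t : nat) :
  (1 <= m)%nat -> weight (sparse_digits m (S N)) t = (3 * t + N * (t / m))%nat.
Proof.
  intros Hm. induction t as [| t IH].
  - rewrite Nat.Div0.div_0_l. simpl; lia.
  - cbn [weight]. rewrite IH, sparse_digits_odd, sparse_digits_even.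
    destruct (Nat.eqb_spec (S t / m) (t / m)) as [E | E]; [rewrite E; lia |].
    destruct (div_succ m t Hm) as [E' | E']; [easy | rewrite E'; lia].
Qed.

Lemma sparse_digits_prod (m N t : nat) :
  (1 <= m)%nat -> digit_prod (sparse_digits m N) t = (N ^ (t / m))%nat.
Proof.
  intros Hm. induction t as [| t IH].
  - now rewrite Nat.Div0.div_0_l.
  - cbn [digit_prod]. rewrite IH, sparse_digits_even.
    destruct (Nat.eqb_spec (S t / m) (t / m)) as [E | E]; [rewrite E; lia |].
    destruct (div_succ m t Hm) as [E' | E']; [easy | rewrite E'; simpl; lia].
Qed.

Lemma sparse_digits_weight_lim (m N : nat) :
  (1 <= m)%nat ->
  is_lim_seq (fun t => INR (weight (sparse_digits m (S N)) t) / INR t)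
             (3 + INR N / INR m).
Proof.
  intros Hm. apply is_lim_seq_spec. intros eps.
  destruct (INR_unbounded (INR N / eps)) as [T HT].
  exists (S T). intros t Ht. rewrite sparse_digits_weight by assumption.
  apply le_INR in Ht. rewrite S_INR in Ht.
  pose proof (Nat.div_mod_eq t m) as Hdm.
  pose proof (Nat.mod_upper_bound t m ltac:(lia)) as Hmod.
  apply (f_equal INR) in Hdm. rewrite plus_INR, mult_INR in Hdm.
  apply lt_INR in Hmod. pose proof (pos_INR (t mod m)). pose proof (pos_INR N).
  pose proof (pos_INR T). apply le_INR in Hm. simpl (INR 1) in Hm.
  rewrite plus_INR, !mult_INR. simpl (INR 3).
  set (d := INR (t / m)) in *. set (e := INR (t mod m)) in *. set (M := INR m) in *.
  pose proof (cond_pos eps) as He.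
  (* The error comes only from the remainder [e] of [t] modulo [m], and is at most $N/t$. *)
  replace (((1 + 1 + 1) * INR t + INR N * d) / INR t - (3 + INR N / M))
    with (- (INR N / INR t * (e / M))).
  - rewrite Rabs_Ropp, Rabs_pos_eq.
    + assert (0 <= INR N / INR t) by (apply Rdiv_le_0_compat; lra).
      assert (0 <= e / M <= 1).
      { split; [apply Rdiv_le_0_compat; lra |]. apply Rle_div_l; lra. }
      assert (INR N / INR t < eps); [| nra].
      apply Rlt_div_l; [lra |]. apply Rlt_div_l in HT; [| lra]. nra.
    + apply Rmult_le_pos; apply Rdiv_le_0_compat; lra.
  - replace e with (INR t - M * d) by lra. field. lra.
Qed.

(** Over [m] blocks the weight grows by $3m + (m+k)$, while the bound for $q^2$ grows by
    $\varphi^{4m} N^2$. The upper slope bound thus shrinks by [rho], which is $\varphi^{-k} N^2 <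
    1$. *)
Lemma DTU_derivative_zero (g : R -> R) (m k : nat) (X : nat -> R) :
  is_DTU (/ phi) g -> (1 <= m)%nat -> is_cf (sparse_digits m (S (m + k))) X ->
  INR (S (m + k)) ^ 2 < phi ^ k ->
  has_derivative_Rbar g (X 0%nat) 0.
Proof.
  intros Hg Hm H Hk. apply is_lim_spec. intros eps.
  set (N := S (m + k)) in *. set (a := sparse_digits m N) in *.
  assert (Ha : forall n, (1 <= a n)%nat) by (intro; apply H).
  pose proof phi_bounds as Hphi. pose proof inv_phi_bounds as Hl.
  assert (HN : 1 <= INR N) by (apply (le_INR 1); unfold N; lia).
  set (rho := (/ phi) ^ k * INR N ^ 2).
  assert (Hlk : 0 < (/ phi) ^ k) by (apply pow_lt; lra).
  assert (Hrho : 0 < rho < 1).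
  { unfold rho. split; [apply Rmult_lt_0_compat; [| apply pow_lt]; lra |].
    rewrite <- (pow_phi_inv k), Rmult_comm. now apply Rmult_lt_compat_r. }
  (* Absorbs the incomplete last period and the shift from [t] to [t + 2]. *)
  set (Cst := phi ^ (m + 12) * INR N ^ 6).
  assert (HCst : 0 < Cst) by (apply Rmult_lt_0_compat; apply pow_lt; lra).
  assert (Heps : 0 < eps / Cst) by (apply Rdiv_lt_0_compat; [apply cond_pos | lra]).
  destruct (pow_lt_1_zero rho ltac:(rewrite Rabs_pos_eq; lra) _ Heps) as [d0 Hd0].
  apply (slope_near g a X (fun z => Rabs (z - 0) < eps) (m * d0) H).
  intros t y Ht Hy.
  destruct (DTU_slope_bounds g a X t y Hg H Hy) as [Hlow Hup].
  rewrite Rminus_0_r, Rabs_pos_eq.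
  2:{ eapply Rle_trans; [| exact Hlow]. apply Rmult_le_pos; [apply pow_le; lra |].
      apply Rmult_le_pos; apply pos_INR. }
  eapply Rle_lt_trans; [exact Hup |].
  set (d := (t / m)%nat).
  assert (Hd : (d0 <= d)%nat) by (apply Nat.div_le_lower_bound; lia).
  assert (Htd : (t <= m * d + m)%nat).
  { pose proof (Nat.div_mod_eq t m). pose proof (Nat.mod_upper_bound t m ltac:(lia)).
    unfold d. lia. }
  assert (Hq : INR (qo a (t + 2)) <= phi ^ (2 * t + 6) * INR N ^ (d + 3)).
  { pose proof (conv_growth_le a (t + 2) Ha (sparse_digits_odd m N)) as G.
    unfold a at 3 in G. rewrite sparse_digits_prod, pow_INR in G by assumption.
    replace (2 * (t + 2) + 2)%nat with (2 * t + 6)%nat in G by lia.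
    pose proof (pos_INR (qe a (t + 2))). pose proof (pos_INR (qo a (t + 2))).
    apply Rle_trans with (phi ^ (2 * t + 6) * INR N ^ (S (t + 2) / m)); [nra |].
    apply Rmult_le_compat_l; [apply pow_le; lra |].
    (* Since $m \ge 1$, $t+3 \le t+3m$, so at most three further large digits occur. *)
    apply Rle_pow; [lra |]. unfold d.
    rewrite <- Nat.div_add by lia. apply Nat.Div0.div_le_mono. lia. }
  apply Rle_lt_trans with (Cst * rho ^ d).
  - assert (Hq2 : INR (qo a (t + 2)) ^ 2 <= phi ^ (4 * t + 12) * INR N ^ (2 * d + 6)).
    { replace (4 * t + 12)%nat with ((2 * t + 6) * 2)%nat by lia.
      replace (2 * d + 6)%nat with ((d + 3) * 2)%nat by lia.
      rewrite !pow_mult, <- Rpow_mult_distr. apply pow_incr. split; [apply pos_INR | exact Hq]. }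
    assert (Hw : (/ phi) ^ weight a t * phi ^ (4 * t + 12) <=
                 phi ^ (m + 12) * ((/ phi) ^ k) ^ d).
    { unfold a, N. rewrite sparse_digits_weight by assumption. fold d.
      replace (3 * t + (m + k) * d)%nat with (3 * t + m * d + k * d)%nat by lia.
      rewrite pow_add, pow_mult.
      assert (phi ^ (4 * t + 12) <= phi ^ (3 * t + m * d) * phi ^ (m + 12))
        by (rewrite <- pow_add; apply Rle_pow; [lra | lia]).
      pose proof (pow_phi_inv (3 * t + m * d)) as E.
      assert (0 < (/ phi) ^ (3 * t + m * d)) by (apply pow_lt; lra).
      assert (0 < ((/ phi) ^ k) ^ d) by (apply pow_lt; lra).
      replace (phi ^ (m + 12) * ((/ phi) ^ k) ^ d) with
        ((/ phi) ^ (3 * t + m * d) * ((/ phi) ^ k) ^ d *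
           (phi ^ (3 * t + m * d) * phi ^ (m + 12))).
      - apply Rmult_le_compat_l; [nra | assumption].
      - transitivity (phi ^ (3 * t + m * d) * (/ phi) ^ (3 * t + m * d) *
                     (phi ^ (m + 12) * ((/ phi) ^ k) ^ d)); [ring | rewrite E; ring]. }
    apply Rle_trans with ((/ phi) ^ weight a t * (phi ^ (4 * t + 12) * INR N ^ (2 * d + 6))).
    + apply Rmult_le_compat_l; [apply pow_le; lra | exact Hq2].
    + rewrite <- Rmult_assoc. unfold Cst, rho.
      rewrite Rpow_mult_distr, <- pow_mult with (x := INR N), pow_add with (x := INR N).
      replace (phi ^ (m + 12) * INR N ^ 6 * (((/ phi) ^ k) ^ d * INR N ^ (2 * d)))
        with (phi ^ (m + 12) * ((/ phi) ^ k) ^ d * (INR N ^ (2 * d) * INR N ^ 6)) by ring.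
      apply Rmult_le_compat_r; [| exact Hw].
      apply Rmult_le_pos; apply pow_le; lra.
  - specialize (Hd0 d Hd). rewrite Rabs_pos_eq in Hd0 by (apply pow_le; lra).
    apply Rlt_div_r in Hd0; lra.
Qed.

(** With $k = 3j$, Bernoulli gives $\varphi^k \ge w^3$ for $w = 1 + j/2$, while the left side is at
    most $36(C+1)^2 w^2$. The choice of [j] makes $36(C+1)^2 = w - 1$. *)
Lemma sqr_lt_pow_phi (C : nat) :
  exists k : nat, (1 <= k)%nat /\ INR (S (C * k + k)) ^ 2 < phi ^ k.
Proof.
  set (j := (72 * (C + 1) * (C + 1))%nat).
  exists (3 * j)%nat. split; [unfold j; lia |].
  assert (Hj : INR j = 72 * (INR C + 1) ^ 2).
  { unfold j. rewrite !mult_INR, plus_INR. replace (INR 72) with 72 by (simpl; lra).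
    simpl (INR 1). ring. }
  assert (E : INR (S (C * (3 * j) + 3 * j)) = (INR C + 1) * 3 * INR j + 1).
  { rewrite S_INR, plus_INR, !mult_INR. simpl (INR 3). ring. }
  pose proof (pos_INR C). pose proof phi_bounds.
  pose proof (poly j (1 / 2) ltac:(lra)) as B.
  set (w := 1 + INR j * (1 / 2)) in *.
  assert (Hw : w = 1 + 36 * (INR C + 1) ^ 2) by (unfold w; rewrite Hj; lra).
  apply Rlt_le_trans with (w ^ 3).
  - rewrite E. replace (INR j) with (2 * w - 2) by (unfold w; lra).
    apply Rle_lt_trans with ((6 * (INR C + 1) * w) ^ 2).
    + assert (1 <= w) by nra. apply pow_incr. nra.
    + replace ((6 * (INR C + 1) * w) ^ 2) with ((w - 1) * w ^ 2)
        by (replace (w - 1) with (36 * (INR C + 1) ^ 2) by lra; ring).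
      assert (0 < w) by nra. nra.
  - rewrite Nat.mul_comm, pow_mult. apply pow_incr.
    split; [nra |]. apply Rle_trans with (1 := B). apply pow_incr. lra.
Qed.

Theorem theorem1 :
  forall g : R -> R, is_DTU (/ phi) g ->
  (forall x : R, 0 < x < 1 -> irrational x ->
     Rbar_lt (LimSup_seq (fun t => S_phi x (2 * t) / INR t)) kappa1 ->
     has_derivative_Rbar g x p_infty) /\
  (forall delta : R, 0 < delta ->
     exists y : R, 0 < y < 1 /\ irrational y /\
       exists L : R, is_lim_seq (fun t => S_phi y (2 * t) / INR t) L /\
         L < kappa1 + delta /\
         has_derivative_Rbar g y 0).
Proof.
  intros g Hg. split.
  - intros x Hx Hi HS. pose proof (is_cf_gauss x Hx Hi) as H.
    destruct (LimSup_seq_lt _ _ HS) as (c & N & Hc & HN).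
    apply (DTU_derivative_infinite g _ _ c N Hg H Hc).
    intros t Ht. rewrite <- (is_cf_S_phi _ _ t H). now apply HN.
  - intros delta Hdelta.
    (* With $m = Ck$ the limit is $3 + (m+k)/m = 4 + 1/C$, so $1/C < \delta$ is what is needed. *)
    destruct (archimed_cor1 delta Hdelta) as (C & HC & HC0).
    destruct (sqr_lt_pow_phi C) as (k & Hk & Hphi).
    assert (Hm : (1 <= C * k)%nat) by nia.
    destruct (is_cf_exists (sparse_digits (C * k) (S (C * k + k)))) as [X HX].
    { intros n. apply sparse_digits_pos. lia. }
    exists (X 0%nat). split; [apply HX |]. split; [now apply is_cf_irrational in HX |].
    exists (3 + INR (C * k + k) / INR (C * k)). split; [| split].
    + apply is_lim_seq_ext with (2 := sparse_digits_weight_lim _ (C * k + k) Hm).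
      intros t. now rewrite <- (is_cf_S_phi _ _ t HX).
    + apply lt_0_INR in HC0. apply le_INR in Hk. simpl (INR 1) in Hk.
      rewrite plus_INR, mult_INR. unfold kappa1.
      replace ((INR C * INR k + INR k) / (INR C * INR k)) with (1 + / INR C)
        by (field; lra).
      lra.
    + now apply (DTU_derivative_zero g (C * k) k X).
Qed.
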